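(* Let $e>0$, $\tau>0$, $\bar h>0$ and $\lambda\in\mathbb R$. Consider the 2-dimensional 9-velocity (D2Q9) lattice Boltzmann model for the shallow water equations with equilibrium distribution $$f_i^{eq}(h,\mathbf u)=\begin{cases}\dfrac{8+\lambda}{9}h-\dfrac{4+\lambda}{6e^2}gh^2-\dfrac{2}{3e^2}h|\mathbf u|^2, & i=0,\\[2ex]\dfrac{1-\lambda}{18}h+\dfrac{1+\lambda}{12e^2}gh^2+\dfrac{1}{3e^2}h\,\boldsymbol\xi_i\cdot\mathbf u+\dfrac{1}{2e^4}h(\boldsymbol\xi_i\cdot\mathbf u)^2-\dfrac{1}{6e^2}h|\mathbf u|^2, & 1\le i\le 4,\\[2ex]\dfrac{\lambda-1}{36}h+\dfrac{2-\lambda}{24e^2}gh^2+\dfrac{1}{12e^2}h\,\boldsymbol\xi_i\cdot\mathbf u+\dfrac{1}{8e^4}h(\boldsymbol\xi_i\cdot\mathbf u)^2-\dfrac{1}{24e^2}h|\mathbf u|^2, & 5\le i\le 8.\end{cases}$$ If $\lambda=1$ and $g\in\left(0,\dfrac{3e^2}{5\bar h}\right)$, or if $\lambda$ is arbitrary and $g=\dfrac{e^2}{3\bar h}$, then this model is stable at the constant state $f_*=f^{eq}(\bar h,\mathbf 0)$, in the sense of the stability structure defined in the context (with $d=2$, $N=9$).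
   Context: **Discrete-velocity Boltzmann equation.** For velocities $\boldsymbol\xi_0,\dots,\boldsymbol\xi_{N-1}\in\mathbb R^d$, consider the system $$\frac{\partial f_i}{\partial t}+\boldsymbol\xi_i\cdot\nabla f_i=J_i(f),\qquad i=0,1,\dots,N-1,$$ for $f=(f_0,\dots,f_{N-1})^T$, with $J(f)=(J_0(f),\dots,J_{N-1}(f))^T$. Let $J_f(f)\in\mathbb R^{N\times N}$ denote the Jacobian matrix of $J$ with respect to $f$. **Stability structure (definition).** Let $f_*$ be a constant state with $J(f_* )=0$. The system is called stable at $f_*$ if there is an invertible matrix $P\in\mathbb R^{N\times N}$ such that $P^TP$ is diagonal, $P^TP=\mathrm{diag}(a_1,\dots,a_N)$, and $$P\,J_f(f_* )=-\mathrm{diag}(\lambda_1,\dots,\lambda_N)\,P$$ with $\lambda_i=0$ for $i\le d+1$ and $\lambda_i>0$ for $i>d+1$. (The numbers $\lambda_i$ here are unrelated to the model parameter $\lambda$.) **The D2Q9 model.** Here $d=2$, $N=9$, $e>0$ is the lattice speed, $g$ is the (reduced) gravity, $\tau>0$ is the relaxation time, $\boldsymbol\xi_0=(0,0)^T$, $\{\boldsymbol\xi_1,\dots,\boldsymbol\xi_4\}=\{(\pm e,0)^T,(0,\pm e)^T\}$ and $\{\boldsymbol\xi_5,\dots,\boldsymbol\xi_8\}=\{(\pm e,\pm e)^T\}$ (all four sign choices). For $f$ with $\sum_i f_i>0$, the water depth $h$ and velocity $\mathbf u\in\mathbb R^2$ are defined by $h=\sum_{i=0}^8 f_i$, $h\mathbf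 u=\sum_{i=0}^8\boldsymbol\xi_i f_i$. The collision term is of BGK type, $$J_i(f)=\frac{f_i^{eq}(h,\mathbf u)-f_i}{\tau},$$ where $h,\mathbf u$ are the functions of $f$ just given and $f^{eq}$ is the equilibrium distribution given in the claim. *)

(* Defs.v *)
From HB Require Import structures.
From mathcomp Require Import all_boot all_order all_algebra.
From mathcomp Require Import boolp classical_sets functions reals topology.
From mathcomp Require Import normedtype derive.
Set Implicit Arguments.
Unset Strict Implicit.
Unset Printing Implicit Defensive.
Import Order.TTheory GRing.Theory Num.Theory.
Import numFieldNormedType.Exports.

Local Open Scope classical_set_scope.
Local Open Scope ring_scope.

(* The system  d_t f_i + xi_i . grad f_i = J_i(f),  0 <= i < N,  in dimension d.
   States f = (f_0, ..., f_(N-1)) are row vectors. *)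
Record discrete_boltzmann (R : realType) (d N : nat) := DiscreteBoltzmann {
  velocity : 'I_N -> 'rV[R]_d ;
  collision : 'rV[R]_N -> 'rV[R]_N }.

(* The library's ['J F f] acts on row vectors from the right (its (j, i) entry
   is d F_i / d f_j), so the usual Jacobian, with (i, j) entry d F_i / d f_j,
   is its transpose. *)
Definition jacobian_matrix (R : realType) (N : nat)
    (F : 'rV[R]_N -> 'rV[R]_N) (f : 'rV[R]_N) : 'M[R]_N :=
  ('J F f)^T.

(* Differentiability is required explicitly because ['J F f] is a total
   function, meaningless where F is not differentiable.  Indices start at 0, so
   "the first d + 1 of the lam_i" are those with i < d + 1. *)
Definition stable_at (R : realType) (d N : nat)
    (S : discrete_boltzmann R d N) (fs : 'rV[R]_N) : Prop :=
  [/\ collision S fs = 0,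
      differentiable (collision S) fs &
      exists (P : 'M[R]_N) (a lam : 'rV[R]_N),
        [/\ P \in unitmx,
            P^T *m P = diag_mx a,
            P *m jacobian_matrix (collision S) fs = - diag_mx lam *m P,
            forall i : 'I_N, (i < d + 1)%N -> lam 0 i = 0 &
            forall i : 'I_N, (d + 1 <= i)%N -> 0 < lam 0 i]].

Definition dot (R : realType) (d : nat) (u v : 'rV[R]_d) : R :=
  \sum_(k < d) u 0 k * v 0 k.

Definition vec2 (R : realType) (x y : R) : 'rV[R]_2 :=
  \row_(k < 2) (if k == 0 then x else y).

(* The order inside each of the two groups of four velocities is left free. *)
Definition D2Q9_velocities (R : realType) (e : R) (xi : 'I_9 -> 'rV[R]_2) :
    Prop :=
  [/\ xi ord0 = vec2 0 0,
      xi @` [set i : 'I_9 | (1 <= i <= 4)%N] =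
        [set vec2 e 0; vec2 (- e) 0; vec2 0 e; vec2 0 (- e)] &
      xi @` [set i : 'I_9 | (5 <= i <= 8)%N] =
        [set vec2 e e; vec2 e (- e); vec2 (- e) e; vec2 (- e) (- e)]].

Definition water_depth (R : realType) (f : 'rV[R]_9) : R :=
  \sum_(i < 9) f 0 i.

(* Meaningful for states of nonzero depth. *)
Definition water_velocity (R : realType) (xi : 'I_9 -> 'rV[R]_2)
    (f : 'rV[R]_9) : 'rV[R]_2 :=
  (water_depth f)^-1 *: \sum_(i < 9) f 0 i *: xi i.

Definition swe_feq (R : realType) (e g lambda : R) (xi : 'I_9 -> 'rV[R]_2)
    (h : R) (u : 'rV[R]_2) : 'rV[R]_9 :=
  \row_(i < 9)
    if (i == 0 :> nat)%N then
      (8 + lambda) / 9 * h - (4 + lambda) / (6 * e ^+ 2) * g * h ^+ 2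
      - 2 / (3 * e ^+ 2) * h * dot u u
    else if (i <= 4)%N then
      (1 - lambda) / 18 * h + (1 + lambda) / (12 * e ^+ 2) * g * h ^+ 2
      + 1 / (3 * e ^+ 2) * h * dot (xi i) u
      + 1 / (2 * e ^+ 4) * h * (dot (xi i) u) ^+ 2
      - 1 / (6 * e ^+ 2) * h * dot u u
    else
      (lambda - 1) / 36 * h + (2 - lambda) / (24 * e ^+ 2) * g * h ^+ 2
      + 1 / (12 * e ^+ 2) * h * dot (xi i) u
      + 1 / (8 * e ^+ 4) * h * (dot (xi i) u) ^+ 2
      - 1 / (24 * e ^+ 2) * h * dot u u.

Definition swe_D2Q9 (R : realType) (e tau g lambda : R)
    (xi : 'I_9 -> 'rV[R]_2) : discrete_boltzmann R 2 9 :=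
  DiscreteBoltzmann xi (fun f =>
    tau^-1 *: (swe_feq e g lambda xi (water_depth f) (water_velocity xi f) - f)).

(* Main.v *)
(** Put s = g h / e^2.  Under either hypothesis on (lambda, g), the derivative
    of the equilibrium with respect to h at rest is the positive weight vector
    w = (1 - 5s/3, s/3 (4 times), s/12 (4 times)), and the Jacobian of f^eq at
    the rest state is
      M_ij = w_i (1 + xi_i . xi_j / c^2),   c^2 = g h.
    With D = diag (sqrt w), D^-1 M D = Q^T Q, where the rows of Q are sqrt w and
    sqrt w xi_x / c, sqrt w xi_y / c; these are orthonormal for the D2Q9
    velocities.  So D^-1 M D is an orthogonal projection of rank 3, and
    completing Q to an orthogonal matrix U gives P = U D^-1, with
    P^T P = D^-2 and relaxation rates 0 (3 times) and 1 / tau (6 times). *)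

Require Import Defs.
From HB Require Import structures.
From mathcomp Require Import all_boot all_order all_algebra.
From mathcomp Require Import reals.
From mathcomp Require Import ring lra boolp classical_sets functions topology.
From mathcomp Require Import normedtype derive.
Import Order.TTheory GRing.Theory Num.Theory.
Import numFieldNormedType.Exports.
Local Open Scope ring_scope.

Set Implicit Arguments.
Unset Strict Implicit.

(** * Linear algebra and finite sums *)

(** Induction on the number [m] of missing rows. In the successor case [Q] has rank at most [k < n],
    so some nonzero row vector is orthogonal to all its rows; normalised by a square root, it is
    appended to [Q]. *)
Lemma orthonormal_completion (R : rcfType) (m k n : nat) (Q : 'M[R]_(k, n)) :
  (k + m = n)%N -> Q *m Q^T = 1%:M ->
  exists B : 'M[R]_(m, n), B *m B^T = 1%:M /\ Q *m B^T = 0.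
Proof.
elim: m k Q => [|m IH] k Q kmn QQ.
  by exists 0; split; [apply/matrixP => -[]|rewrite trmx0 mulmx0].
have [v vQ v0] : exists2 v : 'rV[R]_n, v *m Q^T = 0 & v != 0.
  have kn0 : kermx Q^T != 0.
    rewrite -mxrank_eq0 mxrank_ker subn_eq0 -ltnNge mxrank_tr.
    apply: leq_ltn_trans (rank_leq_row Q) _.
    by rewrite -kmn addnS ltnS leq_addr.
  exists (nz_row (kermx Q^T)); last by rewrite nz_row_eq0.
  by apply/sub_kermxP/nz_row_sub.
pose c := (v *m v^T) 0 0.
have c0 : 0 < c.
  rewrite /c mxE.
  have sq i : v 0 i * v^T i 0 = v 0 i ^+ 2 by rewrite mxE.
  rewrite (eq_bigr _ (fun i _ => sq i)) lt_def sumr_ge0 ?andbT; last first.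
    by move=> i _; rewrite sqr_ge0.
  apply: contra_neq v0 => /psumr_eq0P s0; apply/rowP => i; rewrite mxE.
  by apply/eqP; rewrite -sqrf_eq0 s0// => j _; rewrite sqr_ge0.
pose u := (Num.sqrt c)^-1 *: v.
have uQ : u *m Q^T = 0 by rewrite -scalemxAl vQ scaler0.
have uu : u *m u^T = 1%:M.
  rewrite /u linearZ/= -scalemxAl -scalemxAr.
  rewrite [v *m v^T]mx11_scalar -/c !scale_scalar_mx; congr (_%:M).
  by rewrite mulrA -expr2 exprVn sqr_sqrtr ?ltW// mulVf ?gt_eqF.
have Qu : Q *m u^T = 0 by rewrite -[LHS]trmxK trmx_mul trmxK uQ trmx0.
have [||B [BB QB]] := IH (k + 1)%N (col_mx Q u).
- by rewrite -kmn addnAC addn1 addnS.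
- by rewrite tr_col_mx mul_col_row QQ Qu uQ uu -scalar_mx_block.
move: QB; rewrite mul_col_mx -[0]vsubmxK => /eq_col_mx [].
rewrite !linear0 => QB uB.
have Bu : B *m u^T = 0 by rewrite -[LHS]trmxK trmx_mul trmxK uB trmx0.
(* The row count [m.+1] is restated as the convertible [1 + m], the shape of [col_mx u B]. *)
suff: exists C : 'M[R]_(1 + m, n), C *m C^T = 1%:M /\ Q *m C^T = 0 by [].
exists (col_mx u B); rewrite tr_col_mx; split.
  by rewrite mul_col_row uu uB Bu BB -scalar_mx_block.
by rewrite mul_mx_row Qu QB row_mx0.
Qed.

(** Pigeonhole: [s] is duplicate-free, contained in the image and at least as long as [A], so the
    listed image has no repetition and is a permutation of [s]. This frees sums from the order in
    which velocities are numbered. *)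
Lemma sum_over_image (I : finType) (T : eqType) (V : nmodType) (xi : I -> T)
    (A : pred I) (s : seq T) (F : T -> V) :
  uniq s -> (#|A| <= size s)%N -> {subset s <= [seq xi i | i in A]} ->
  \sum_(i | A i) F (xi i) = \sum_(v <- s) F v.
Proof.
move=> us As sA.
have sz : (size [seq xi i | i in A] <= size s)%N by rewrite size_image.
have uA := leq_size_uniq us sA sz.
have [_ eqm] := uniq_min_size us sA sz.
rewrite (perm_big _ (uniq_perm us uA eqm)) /= big_map big_enum_cond/=.
by apply: eq_bigl => i; rewrite andbT.
Qed.

(** * Rules for differentials *)

Section Differentials.
Variable R : realType.

Lemma is_diff_sum (V W : normedModType R) (n : nat) (f df : 'I_n -> V -> W)
    (x : V) :
  (forall i, is_diff x (f i) (df i)) ->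
  is_diff x (fun y => \sum_(i < n) f i y) (fun v => \sum_(i < n) df i v).
Proof.
move=> fdf.
have E (g : 'I_n -> V -> W) : (fun y => \sum_i g i y) = \sum_i g i.
  by apply/funext => y; rewrite fct_sumE.
rewrite !E; elim/big_rec2: _ => [|i dg g _ gdg]; first exact: is_diff_cst.
exact: is_diffD.
Qed.

Lemma is_diff_coord (n : nat) (i : 'I_n) (x : 'rV[R]_n) :
  is_diff x (fun y : 'rV[R]_n => y 0 i) (fun v => v 0 i).
Proof.
have lin : linear (fun y : 'rV[R]_n => y 0 i : R).
  by move=> a u v; rewrite !mxE.
(* Bundled as a linear map, the coordinate is its own differential by [diff_lin]. *)
pose fM := GRing.isLinear.Build _ _ _ _ _ lin.
pose f : {linear _ -> _} := HB.pack (fun y : 'rV[R]_n => y 0 i : R) fM.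
apply: DiffDef; first exact: differentiable_coord.
by rewrite (@diff_lin _ _ _ f) //; exact: coord_continuous.
Qed.

Lemma is_diff_rV (V : normedModType R) (n : nat) (f df : V -> 'rV[R]_n)
    (x : V) :
  (forall i, is_diff x (fun y => f y 0 i) (fun v => df v 0 i)) ->
  is_diff x f df.
Proof.
move=> fdf.
have E (g : V -> 'rV[R]_n) :
    g = (fun y => \sum_i (g y 0 i *: delta_mx 0 i : 'rV[R]_n)).
  by apply/funext => y; rewrite -row_sum_delta.
rewrite [f]E [df]E; apply: is_diff_sum => i.
exact: (@is_diff_comp _ _ _ _ _ _ _ _ _ (fdf i) (is_diff_scalel _ _)).
Qed.

Lemma is_diff_inv (V : normedModType R) (f df : V -> R) (x : V) :
  f x != 0 -> is_diff x f df ->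
  is_diff x (fun y => (f y)^-1) (fun v => - (f x) ^- 2 * df v).
Proof.
move=> fx0 fdf; apply: DiffDef; first exact: differentiableV.
by rewrite diffV// diff_val.
Qed.

End Differentials.

(** * A stability criterion for weighted projections *)

(** Here [s] holds the square roots of the weights. The differential multiplies row vectors on the
    right, so its matrix is the transpose of [D *m Q^T *m Q *m D']; hence the reversed order of the
    diagonal factors. *)
Lemma stable_of_weighted_projection (R : realType) (d m : nat)
    (S : discrete_boltzmann R d (d + 1 + m)) (fs s : 'rV[R]_(d + 1 + m))
    (tau : R) (Q : 'M[R]_(d + 1, d + 1 + m)) :
  0 < tau -> (forall i, 0 < s 0 i) -> Q *m Q^T = 1%:M ->
  collision S fs = 0 ->
  is_diff fs (collision S)
    (fun v => tau^-1 *: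
       (v *m (diag_mx (map_mx GRing.inv s) *m Q^T *m Q *m diag_mx s) - v)) ->
  stable_at S fs.
Proof.
move=> tau0 s0 QQ S0 dS.
have [B [BB QB]] := orthonormal_completion erefl QQ.
set D' := diag_mx (map_mx GRing.inv s) in dS *; set D := diag_mx s in dS *.
pose U := col_mx Q B.
have BQ : B *m Q^T = 0 by rewrite -[LHS]trmxK trmx_mul trmxK QB trmx0.
have UU : U *m U^T = 1%:M.
  by rewrite tr_col_mx mul_col_row QQ BB QB BQ -scalar_mx_block.
have UU' := mulmx1C UU.
have DD' : D *m D' = 1%:M.
  rewrite mul_diag_mx; apply/matrixP => i j; rewrite !mxE.
  by case: eqP => [->|_]; rewrite ?mulr0n ?mulr0// mulr1n divff// gt_eqF.
have trD (x : 'rV[R]_(d + 1 + m)) : (diag_mx x)^T = diag_mx x.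
  by rewrite tr_diag_mx.
have J : jacobian_matrix (collision S) fs =
    tau^-1 *: (D *m Q^T *m Q *m D' - 1%:M).
  rewrite /jacobian_matrix -[RHS]trmxK; congr (_^T).
  rewrite linearZ linearB/= !trmx_mul trmxK trmx1 !trD !mulmxA.
  (* Row [i] of the untransposed Jacobian is the differential at the [i]-th basis vector. *)
  apply/row_matrixP => i; rewrite !rowE mul_rV_lin1 diff_val.
  by rewrite -scalemxAr mulmxBr mulmx1 !mulmxA.
split=> //.
pose lam : 'rV[R]_(d + 1 + m) := row_mx 0 (const_mx tau^-1).
exists (U *m D'), (\row_i (s 0 i) ^- 2), lam; split.
- by rewrite unitmx_mul; apply/andP; split;
    [have [] := mulmx1_unit UU|have [] := mulmx1_unit DD'].
- rewrite trmx_mul trD mulmxA -(mulmxA D') UU' mulmx1 mul_diag_mx.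
  apply/matrixP => i j; rewrite !mxE.
  by case: eqP => [->|_]; rewrite ?mulr0n ?mulr0// !mulr1n -invfM.
(* In the orthonormal basis [U] the projection becomes the identity on the first [d + 1] coordinates
   and zero on the rest, as the rows of [B] are orthogonal to those of [Q]. *)
- have UQ : U *m Q^T *m Q = block_mx 1%:M 0 0 0 *m U.
    by rewrite mul_col_mx QQ BQ mul_col_mx mul1mx mul0mx mul_block_col
       !mul0mx mul1mx !addr0.
  rewrite J -scalemxAr mulmxBr mulmx1 !mulmxA
    -(mulmxA U D') (mulmx1C DD') mulmx1.
  rewrite UQ -!mulmxA -{2}[U *m D']mul1mx -mulmxBl scalemxAl; congr (_ *m _).
  rewrite (scalar_mx_block (d + 1) m) opp_block_mx add_block_mx !subr0 !sub0r.
  rewrite ?subrr ?oppr0 scale_block_mx !scaler0 diag_mx_row opp_block_mx.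
  by rewrite diag_const_mx scalerN scale_scalar_mx mulr1; congr block_mx;
    apply/matrixP=> i j; rewrite !mxE ?mul0rn ?oppr0.
- by move=> i id; rewrite mxE; case: splitP => j ij; rewrite ?mxE//;
    move: id; rewrite ij ltnNge leq_addr.
- by move=> i id; rewrite mxE; case: splitP => j ij; rewrite ?mxE ?invr_gt0//;
    move: id; rewrite ij leqNgt ltn_ord.
Qed.

(** * Sums over the nine velocities *)

Section Velocities.
Variables (R : realType) (e : R) (xi : 'I_9 -> 'rV[R]_2).
Hypotheses (e0 : 0 < e) (xiP : D2Q9_velocities e xi).

Lemma vec2_eq (x y x' y' : R) :
  (vec2 x y == vec2 x' y') = (x == x') && (y == y').
Proof.
apply/eqP/andP => [/rowP E|[/eqP-> /eqP->]//].
by have := E 0; have := E 1; rewrite !mxE/= => -> ->.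
Qed.

Lemma sum_D2Q9 (V : nmodType) (F0 F1 F2 : 'rV[R]_2 -> V) :
  \sum_(i < 9) (if (i == 0 :> nat)%N then F0 (xi i)
                else if (i <= 4)%N then F1 (xi i) else F2 (xi i)) =
  F0 (vec2 0 0) +
  \sum_(v <- [:: vec2 e 0; vec2 (- e) 0; vec2 0 e; vec2 0 (- e)]) F1 v +
  \sum_(v <- [:: vec2 e e; vec2 e (- e); vec2 (- e) e; vec2 (- e) (- e)]) F2 v.
Proof.
case: xiP => xi0 xi1 xi2.
(* These comparisons settle every equality test in the [uniq] goals below. *)
have eN : (e == - e) = false.
  by rewrite -subr_eq0 opprK -mulr2n mulrn_eq0 (gt_eqF e0).
have eN' : (- e == e) = false by rewrite eq_sym.
have ez : (e == 0) = false by rewrite gt_eqF.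
have eNz : (- e == 0) = false by rewrite oppr_eq0.
have e_ : (0 == e) = false by rewrite eq_sym.
have eN_ : (0 == - e) = false by rewrite eq_sym.
have cE := (eN, eN', ez, eNz, e_, eN_).
rewrite (bigD1 ord0)//= xi0 -addrA (bigID (fun i : 'I_9 => (i <= 4)%N))/=.
congr (_ + (_ + _)).
- rewrite -(sum_over_image (xi := xi)
               (A := fun i : 'I_9 => (1 <= i <= 4)%N)).
  + by apply: eq_big => i; case: i => -[|[|[|[|[|[|[|[|[|]]]]]]]]].
  + by rewrite /= !inE !vec2_eq !eqxx !cE.
  + by rewrite -sum1_card !big_mkcond !big_ord_recl big_ord0.
  + move=> v; rewrite !inE => vP.
    have : (xi @` [set i : 'I_9 | (1 <= i <= 4)%N])%classic v.
      by rewrite xi1; move: vP => /or4P[]/eqP->;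
        [left; left; left|left; left; right|left; right|right].
    by case=> i iP <-; apply/fintype.imageP; exists i.
- rewrite -(sum_over_image (xi := xi)
               (A := fun i : 'I_9 => (5 <= i <= 8)%N)).
  + by apply: eq_big => i; case: i => -[|[|[|[|[|[|[|[|[|]]]]]]]]].
  + by rewrite /= !inE !vec2_eq !eqxx !cE.
  + by rewrite -sum1_card !big_mkcond !big_ord_recl big_ord0.
  + move=> v; rewrite !inE => vP.
    have : (xi @` [set i : 'I_9 | (5 <= i <= 8)%N])%classic v.
      by rewrite xi2; move: vP => /or4P[]/eqP->;
        [left; left; left|left; left; right|left; right|right].
    by case=> i iP <-; apply/fintype.imageP; exists i.
Qed.

End Velocities.

(** * Linearisation of the collision term at zero momentum *)

Section CollisionDifferential.
Variables (R : realType) (e tau g lambda : R) (xi : 'I_9 -> 'rV[R]_2).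

Definition momentum (f : 'rV[R]_9) : 'rV[R]_2 := \sum_(i < 9) f 0 i *: xi i.

Lemma is_diff_momentum_coord (f : 'rV[R]_9) (k : 'I_2) :
  is_diff f (fun y => momentum y 0 k) (fun v => momentum v 0 k).
Proof.
have E : (fun y => momentum y 0 k) = (fun y => \sum_i xi i 0 k * y 0 i).
  apply/funext => y; rewrite summxE; apply: eq_bigr => i _.
  by rewrite mxE mulrC.
rewrite E; apply: is_diff_sum => i.
exact: (is_diffZ (xi i 0 k) (is_diff_coord i f)).
Qed.

Lemma is_diff_water_depth (f : 'rV[R]_9) :
  is_diff f (@water_depth R) (@water_depth R).
Proof. by apply: is_diff_sum => i; exact: is_diff_coord. Qed.

(** In the product rule, the term that differentiates the inverse depth carries the factor
    [momentum f = 0]. *)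
Lemma is_diff_water_velocity (f : 'rV[R]_9) :
  water_depth f != 0 -> momentum f = 0 ->
  is_diff f (water_velocity xi)
    (fun v => (water_depth f)^-1 *: momentum v).
Proof.
move=> f0 mf0; apply: is_diff_rV => k.
have E : (fun y => water_velocity xi y 0 k) =
    (fun y => (water_depth y)^-1) * (fun y => momentum y 0 k).
  by apply/funext => y; rewrite mxE.
rewrite E; apply: (is_diff_eq (is_diffM
  (is_diff_inv f0 (is_diff_water_depth f)) (is_diff_momentum_coord f k))).
by apply/funext => v; rewrite !fctE mf0 !mxE scale0r addr0.
Qed.

Lemma is_diff_dotl (V : normedModType R) (d : nat) (w : 'rV[R]_d)
    (f df : V -> 'rV[R]_d) (x : V) :
  is_diff x f df -> is_diff x (fun y => dot w (f y)) (fun v => dot w (df v)).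
Proof.
move=> fdf; apply: is_diff_sum => k.
exact: (is_diffZ (w 0 k) (is_diff_comp fdf (is_diff_coord k _))).
Qed.

Lemma is_diff_dot_self (V : normedModType R) (d : nat)
    (f df : V -> 'rV[R]_d) (x : V) :
  f x = 0 -> is_diff x f df -> is_diff x (fun y => dot (f y) (f y)) (fun=> 0).
Proof.
move=> fx0 fdf.
have fdfk k := is_diff_comp fdf (is_diff_coord k (f x)).
apply: (is_diff_eq (is_diff_sum (fun k => is_diffM (fdfk k) (fdfk k)))).
apply/funext => v; rewrite big1// => k _.
by rewrite !fctE/= fx0 mxE !scale0r addr0.
Qed.

(** A common template for the three branches of the equilibrium, with [X] for [xi_i . u] and [Y] for
    [|u|^2]. Since [X], [Y] and the differential of [Y] vanish at [x], the [q] and [p] terms have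
    zero differential. *)
Lemma is_diff_equilibrium_shape (V : normedModType R) (h dh X dX Y : V -> R)
    (x : V) (a b c q p : R) :
  is_diff x h dh -> is_diff x X dX -> is_diff x Y (fun=> 0) ->
  X x = 0 -> Y x = 0 ->
  is_diff x (fun y => a * h y + b * h y ^+ 2 + c * h y * X y
                      + q * h y * X y ^+ 2 + p * h y * Y y)
    (fun v => (a + 2 * b * h x) * dh v + c * h x * dX v).
Proof.
move=> hdh XdX YdY X0 Y0.
have H := is_diffD (is_diffD (is_diffD (is_diffD (is_diffZ a hdh)
  (is_diffZ b (is_diffM hdh hdh))) (is_diffZ c (is_diffM hdh XdX)))
  (is_diffZ q (is_diffM hdh (is_diffM XdX XdX))))
  (is_diffZ p (is_diffM hdh YdY)).
have E : (fun y => a * h y + b * h y ^+ 2 + c * h y * X y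
                      + q * h y * X y ^+ 2 + p * h y * Y y) =
  a *: h + b *: (h * h) + c *: (h * X) + q *: (h * (X * X)) + p *: (h * Y).
  apply/funext => y; rewrite !fctE /GRing.scale/=; ring.
rewrite E; apply: (is_diff_eq H).
apply/funext => v; rewrite !fctE X0 Y0 /GRing.scale/=; ring.
Qed.

Definition feq_depth_slope (h : R) (i : 'I_9) : R :=
  if (i == 0 :> nat)%N then
    (8 + lambda) / 9 - (4 + lambda) / (3 * e ^+ 2) * g * h
  else if (i <= 4)%N then
    (1 - lambda) / 18 + (1 + lambda) / (6 * e ^+ 2) * g * h
  else (lambda - 1) / 36 + (2 - lambda) / (12 * e ^+ 2) * g * h.

(** The coefficient of [h (xi_i . u)] in the equilibrium; as [h u] is the momentum, it multiplies
    the momentum directly. *)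
Definition feq_momentum_slope (i : 'I_9) : R :=
  if (i == 0 :> nat)%N then 0
  else if (i <= 4)%N then 1 / (3 * e ^+ 2) else 1 / (12 * e ^+ 2).

Lemma is_diff_collision (f : 'rV[R]_9) :
  e != 0 -> water_depth f != 0 -> momentum f = 0 ->
  is_diff f (collision (swe_D2Q9 e tau g lambda xi))
    (fun v => tau^-1 *:
      (\row_i (feq_depth_slope (water_depth f) i * water_depth v
               + feq_momentum_slope i * dot (xi i) (momentum v)) - v)).
Proof.
move=> e0 f0 mf0; apply: is_diff_rV => i.
have u0 : water_velocity xi f = 0.
  by rewrite /water_velocity -/(momentum f) mf0 scaler0.
have dh := is_diff_water_depth f.
have du := is_diff_water_velocity f0 mf0.
have dX := is_diff_dotl (xi i) du.
have dY := is_diff_dot_self u0 du.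
have X0 : dot (xi i) (water_velocity xi f) = 0.
  by rewrite u0 /dot big1// => k _; rewrite mxE mulr0.
have Y0 : dot (water_velocity xi f) (water_velocity xi f) = 0.
  by rewrite u0 /dot big1// => k _; rewrite mxE mulr0.
have dotZ v : dot (xi i) ((water_depth f)^-1 *: momentum v) =
    (water_depth f)^-1 * dot (xi i) (momentum v).
  by rewrite mulr_sumr; apply: eq_bigr => k _; rewrite mxE mulrCA.
have D a b c q p := is_diffZ (tau^-1) (is_diffB
  (is_diff_equilibrium_shape a b c q p dh dX dY X0 Y0)
  (is_diff_coord i f)).
(* [sel] chooses the template coefficients by branch. The rest particle has no [(xi_i . u)^2] term,
   hence the 0 in the fourth slot. *)
pose sel (x y z : R) :=
  if (i == 0 :> nat)%N then x else if (i <= 4)%N then y else z.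
have := D (sel ((8 + lambda) / 9) ((1 - lambda) / 18) ((lambda - 1) / 36))
  (sel (- ((4 + lambda) / (6 * e ^+ 2) * g)) ((1 + lambda) / (12 * e ^+ 2) * g)
       ((2 - lambda) / (24 * e ^+ 2) * g))
  (feq_momentum_slope i)
  (sel 0 (1 / (2 * e ^+ 4)) (1 / (8 * e ^+ 4)))
  (sel (- (2 / (3 * e ^+ 2))) (- (1 / (6 * e ^+ 2))) (- (1 / (24 * e ^+ 2)))).
set F := (F in is_diff f F _); set dF := (dF in is_diff f _ dF).
have -> : F = (fun y => collision (swe_D2Q9 e tau g lambda xi) y 0 i).
  apply/funext => y.
  rewrite /F /feq_momentum_slope /sel !fctE !mxE /GRing.scale/=.
  by case: ifP => _; [|case: ifP => _]; congr (_ * (_ - _)); ring.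
move=> H; apply: (is_diff_eq H); apply/funext => v.
rewrite /dF /feq_momentum_slope /feq_depth_slope /sel !fctE !mxE.
(* The depth in front of [X] cancels the inverse depth produced by [dotZ]. *)
rewrite dotZ /GRing.scale/=.
by case: ifP => _; [|case: ifP => _]; congr (_ * (_ - _)); field;
  rewrite ?e0 ?f0.
Qed.

End CollisionDifferential.

(** * Moments of the rest state and of the weights *)

Section Moments.
Variables (R : realType) (e : R) (xi : 'I_9 -> 'rV[R]_2).
Hypotheses (e0 : 0 < e) (xiP : D2Q9_velocities e xi).

(** Over the nine directions the coefficients of [h] add up to 1 and those of [g h^2] to 0; the
    momentum vanishes because each group of velocities is symmetric under negation. *)
Lemma swe_feq_rest_moments (g lambda h : R) :
  water_depth (swe_feq e g lambda xi h 0) = h /\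
  momentum xi (swe_feq e g lambda xi h 0) = 0.
Proof.
have en0 : e != 0 by rewrite gt_eqF.
have dot0 (v : 'rV[R]_2) : dot v 0 = 0.
  by rewrite /dot big1// => k _; rewrite mxE mulr0.
pose k0 := (8 + lambda) / 9 * h - (4 + lambda) / (6 * e ^+ 2) * g * h ^+ 2.
pose k1 := (1 - lambda) / 18 * h + (1 + lambda) / (12 * e ^+ 2) * g * h ^+ 2.
pose k2 := (lambda - 1) / 36 * h + (2 - lambda) / (24 * e ^+ 2) * g * h ^+ 2.
have fE i : swe_feq e g lambda xi h 0 0 i =
    if (i == 0 :> nat)%N then k0 else if (i <= 4)%N then k1 else k2.
  by rewrite mxE !dot0 expr0n !mulr0 !subr0 !addr0.
split.
  rewrite /water_depth (eq_bigr _ (fun i _ => fE i)).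
  rewrite (sum_D2Q9 e0 xiP (fun=> k0) (fun=> k1) (fun=> k2)).
  by rewrite !big_cons !big_nil /k0 /k1 /k2; field.
rewrite /momentum.
under eq_bigr => i _ do rewrite fE !(fun_if (fun c => c *: xi i)).
rewrite (sum_D2Q9 e0 xiP ( *:%R k0) ( *:%R k1) ( *:%R k2)).
by apply/rowP => k; rewrite !big_cons !big_nil !mxE; case: ifP => _; ring.
Qed.

Definition rest_weight (s : R) (i : 'I_9) : R :=
  if (i == 0 :> nat)%N then 1 - 5 / 3 * s
  else if (i <= 4)%N then s / 3 else s / 12.

(* With c the gravity wave speed, (v_x / c, v_y / c, 1): the collision
   invariants at velocity v, normalised to be orthonormal for rest_weight. *)
Definition hydro_modes (c : R) (v : 'rV[R]_2) : 'rV[R]_(2 + 1) :=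
  row_mx (c^-1 *: v) (const_mx 1).

(** The weights sum to 1, odd and mixed moments cancel by symmetry, and each diagonal second moment
    is [(2 s/3 + 4 s/12) e^2 = s e^2 = c^2]. *)
Lemma hydro_modes_orthonormal (c : R) (k l : 'I_(2 + 1)) : c != 0 ->
  \sum_(i < 9) rest_weight (c ^+ 2 / e ^+ 2) i
     * hydro_modes c (xi i) 0 k * hydro_modes c (xi i) 0 l = (k == l)%:R.
Proof.
move=> c0; have en0 : e != 0 by rewrite gt_eqF.
set s := c ^+ 2 / e ^+ 2.
pose F a v := a * hydro_modes c v 0 k * hydro_modes c v 0 l.
have wF i : rest_weight s i * hydro_modes c (xi i) 0 k
      * hydro_modes c (xi i) 0 l =
    if (i == 0 :> nat)%N then F (1 - 5 / 3 * s) (xi i)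
    else if (i <= 4)%N then F (s / 3) (xi i) else F (s / 12) (xi i).
  by rewrite /rest_weight; case: ifP => _; [|case: ifP => _].
rewrite (eq_bigr _ (fun i _ => wF i)) (sum_D2Q9 e0 xiP) /F !big_cons !big_nil.
rewrite /hydro_modes /s.
case: (split_ordP k) => i ->; case: (split_ordP l) => j ->;
  rewrite eq_shift ?row_mxEl ?row_mxEr !mxE ?[i]ord1 ?[j]ord1.
- by case: i j => -[|[|//]] ? [[|[|//]] ?] /=; field; rewrite en0 c0.
- by case: i => -[|[|//]] ? /=; field; rewrite en0 c0.
- by case: j => -[|[|//]] ? /=; field; rewrite en0 c0.
- by rewrite eqxx /=; field; rewrite en0.
Qed.

(** For moving particles [s] cancels between the weight and the denominator. At [i = 0] the two
    coefficients differ, but [xi_0 = 0] makes both sides vanish. *)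
Lemma feq_momentum_slope_dot (s : R) (i : 'I_9) (v : 'rV[R]_2) : s != 0 ->
  feq_momentum_slope e i * dot (xi i) v =
  rest_weight s i * (dot (xi i) v / (s * e ^+ 2)).
Proof.
move=> s0; have en0 : e != 0 by rewrite gt_eqF.
rewrite /rest_weight /feq_momentum_slope; case: ifP => i0.
  have -> : i = ord0 by apply/val_inj/eqP.
  case: xiP => -> _ _.
  by rewrite /dot big1 ?mul0r ?mulr0// => k _; rewrite !mxE if_same mul0r.
by case: ifP => _; field; rewrite en0 s0.
Qed.

End Moments.

(** * Stability of the rest state *)

Unset Implicit Arguments.
Set Strict Implicit.

Theorem proposition3 (R : realType) (e tau hbar lambda g : R)
    (xi : 'I_9 -> 'rV[R]_2) :
  0 < e -> 0 < tau -> 0 < hbar ->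
  D2Q9_velocities e xi ->
  (lambda = 1 /\ 0 < g < 3 * e ^+ 2 / (5 * hbar)) \/
    g = e ^+ 2 / (3 * hbar) ->
  stable_at (swe_D2Q9 e tau g lambda xi) (swe_feq e g lambda xi hbar 0).
Proof.
move=> e0 tau0 h0 xiP lamg.
have en0 : e != 0 by rewrite gt_eqF.
have hn0 : hbar != 0 by rewrite gt_eqF.
have g0 : 0 < g.
  case: lamg => [[_ /andP[]]//|->].
  by rewrite divr_gt0 ?mulr_gt0 ?exprn_gt0.
have gh0 : 0 < g * hbar by rewrite mulr_gt0.
pose s := g * hbar / e ^+ 2.
have s0 : 0 < s by rewrite divr_gt0 ?exprn_gt0.
(* The first alternative gives [s < 3/5], the second [s = 1/3]. *)
have s1 : 0 < 1 - 5 / 3 * s.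
  have e2 : 0 < e ^+ 2 by rewrite exprn_gt0.
  case: lamg => [[_ /andP[_]]|gE].
    rewrite ltr_pdivlMr ?mulr_gt0// => lt3.
    rewrite subr_gt0 /s mulrA ltr_pdivrMr//; lra.
  have -> : s = 1 / 3 by rewrite /s gE; field; rewrite en0 hn0.
  by lra.
(* lambda only enters through (1 - lambda) (1 - 3 s). *)
have wE i : feq_depth_slope e g lambda hbar i = rest_weight s i.
  rewrite /rest_weight /feq_depth_slope /s; case: lamg => [[-> _]|->];
    by case: ifP => _; [|case: ifP => _]; field; rewrite ?en0 ?hn0.
have w0 i : 0 < rest_weight s i.
  by rewrite /rest_weight; case: ifP => _; [|case: ifP => _]; lra.
have [fs_depth fs_mom] := swe_feq_rest_moments e0 xiP g lambda hbar.
set fs := swe_feq _ _ _ _ _ _ in fs_depth fs_mom *.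
pose c := Num.sqrt (g * hbar).
have c2 : c ^+ 2 = g * hbar by rewrite sqr_sqrtr// ltW.
have c0 : c != 0 by rewrite gt_eqF// sqrtr_gt0.
(* The index bound 9 is written [2 + 1 + 6] to match the criterion: 3 conserved modes and 6 relaxing
   ones. *)
pose sw : 'rV[R]_(2 + 1 + 6) := \row_i Num.sqrt (rest_weight s i).
have sw2 i : sw 0 i * sw 0 i = rest_weight s i.
  by rewrite mxE -expr2 sqr_sqrtr// ltW.
have sw0 i : 0 < sw 0 i by rewrite mxE sqrtr_gt0.
pose q v := hydro_modes c v.
pose Q : 'M[R]_(2 + 1, 2 + 1 + 6) := \matrix_(k, i) (q (xi i) 0 k * sw 0 i).
have QE k i : Q k i = q (xi i) 0 k * sw 0 i by rewrite [LHS]mxE.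
apply: (@stable_of_weighted_projection R 2 6 _ fs sw tau Q tau0 sw0).
- apply/matrixP => k l; rewrite mxE [RHS]mxE.
  rewrite -(hydro_modes_orthonormal e0 xiP k l c0) c2 -/s.
  apply: eq_bigr => i _.
  by rewrite [Q^T i l]mxE !QE mulrACA sw2 mulrC mulrA.
- rewrite /= fs_depth /water_velocity -/(momentum xi fs) fs_mom scaler0.
  by rewrite subrr scaler0.
- have H := @is_diff_collision _ e tau g lambda xi fs en0 _ fs_mom.
  rewrite fs_depth in H; apply: (is_diff_eq (H hn0)); apply/funext => v.
  congr (_ *: (_ - _)); apply/rowP => i.
  rewrite [LHS]mxE wE (@feq_momentum_slope_dot _ _ _ e0 xiP s) ?gt_eqF// -mulrDr.
  have -> : s * e ^+ 2 = c ^+ 2 by rewrite c2 divfK// expf_neq0.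
  rewrite !mulmxA mul_mx_diag [RHS]mxE.
  (* The inverse square roots cancel those in [Q], leaving the scaled momentum and the depth of
     [v]. *)
  have -> : v *m diag_mx (map_mx GRing.inv sw) *m Q^T =
      row_mx (c^-1 *: momentum xi v) (const_mx (water_depth v)).
    apply/rowP => k; rewrite mul_mx_diag mxE.
    transitivity (\sum_j v 0 j * q (xi j) 0 k).
      apply: eq_bigr => j _.
      rewrite mxE [Q^T j k]mxE QE [map_mx _ _ _ _]mxE mulrCA -mulrA.
      by rewrite mulVf ?mulr1 ?gt_eqF// mulrC.
    case: (split_ordP k) => l ->; rewrite ?row_mxEl ?row_mxEr.
      rewrite mxE summxE mulr_sumr; apply: eq_bigr => j _.
      by rewrite row_mxEl !mxE mulrCA.
    rewrite mxE; apply: eq_bigr => j _.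
    by rewrite row_mxEr mxE mulr1.
  (* Expanding back along the modes at [xi i] gives one factor [sw 0 i]; the final diagonal matrix
     supplies the second, which completes the weight. *)
  have -> : (row_mx (c^-1 *: momentum xi v) (const_mx (water_depth v)) *m Q) 0 i =
      (water_depth v + dot (xi i) (momentum xi v) / c ^+ 2) * sw 0 i.
    rewrite mxE big_split_ord/= big_ord1 row_mxEr mxE QE /q row_mxEr mxE mul1r.
    rewrite mulrDl addrC; congr (_ + _).
    rewrite !mulr_suml; apply: eq_bigr => l _.
    rewrite row_mxEl QE row_mxEl mxE [in LHS]mxE; field; exact: c0.
  by rewrite -mulrA sw2 mulrC.
Qed.
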